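(* Let $p:\mathbb{R}^n\to[1,\infty)$ be Lebesgue measurable with $1<\underline p\le p(x)\le \overline p<\infty$ for $x\in\mathbb{R}^n$, where $\underline p=\operatorname{ess\,inf}_{x\in\mathbb{R}^n}p(x)$ and $\overline p=\operatorname{ess\,sup}_{x\in\mathbb{R}^n}p(x)$, and suppose that $$\int_{\mathbb{R}^n}\delta^{\frac{\underline p\,p(x)}{p(x)-\underline p}}\,dx<\infty$$ for some constant $\delta\in(0,1)$. Let $T$ be a sublinear operator acting boundedly from $L_{\underline p}(\mathbb{R}^n)$ to $L_{p(x)}(\mathbb{R}^n)$ such that, for any $f\in L_1(\mathbb{R}^n)$ with compact support and any $x\notin \operatorname{supp} f$, $$|Tf(x)|\le C_0\int_{\mathbb{R}^n}\frac{|f(y)|}{|x-y|^n}\,dy,$$ where $C_0>0$ is independent of $f$ and $x$. Moreover, let $v$ and $w$ be weight functions on $\mathbb{R}^n$ satisfying, for some $0<\alpha,\beta<1$, the conditions $$A_1=\sup_{t>0}\left(\int_{|y|<t}[v(y)]^{-\overline p^{\,\prime}}\,dy\right)^{\frac{\alpha}{\overline p^{\,\prime}}}\left\|\frac{w(\cdot)}{|\cdot|^n}\left(\int_{|y|<|\cdot|}[v(y)]^{-\overline p^{\,\prime}}\,dy\right)^{\frac{1-\alpha}{\overline p^{\,\prime}}}\right\|_{L_{p(\cdot)}(|\cdot|>t)}<\infty,$$ $$B=\sup_{t>0}\left(\int_{|y|>t}[v(y)|y|^n]^{-\overline p^{\,\prime}}\,dy\right)^{\frac{\beta}{\overline p^{\,\prime}}}\left\|w(\cdot)\left(\int_{|y|>|\cdot|}[v(y)|y|^n]^{-\overline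 p^{\,\prime}}\,dy\right)^{\frac{1-\beta}{\overline p^{\,\prime}}}\right\|_{L_{p(\cdot)}(|\cdot|<t)}<\infty,$$ and suppose there exists $M>0$ such that, for every $x\in\mathbb{R}^n\setminus\{0\}$, $$\sup_{|x|/4<|y|\le 4|x|}w(y)\le M\,\operatorname*{ess\,inf}_{z\in\mathbb{R}^n}v(z).$$ Then there exists a positive constant $C$, independent of $f$, such that for all $f\in L_{p(x),v}(\mathbb{R}^n)$ $$\|Tf\|_{L_{p(x),w}(\mathbb{R}^n)}\le C\,\|f\|_{L_{p(x),v}(\mathbb{R}^n)}.$$
   Context: Functions are Lebesgue measurable on $\mathbb{R}^n$, and $|x|$ is the Euclidean norm. A weight function is a Lebesgue measurable function on $\mathbb{R}^n$ that is nonnegative and positive almost everywhere. For a measurable set $\Omega\subseteq\mathbb{R}^n$ and a measurable exponent $p$ with $1\le p(x)\le\overline p<\infty$, the variable Lebesgue space $L_{p(x)}(\Omega)=L_{p(\cdot)}(\Omega)$ is the space of measurable $f$ on $\Omega$ with finite Luxemburg norm $$\|f\|_{L_{p(\cdot)}(\Omega)}=\inf\left\{\lambda>0:\int_\Omega\left(\frac{|f(x)|}{\lambda}\right)^{p(x)}dx\le1\right\}.$$ For a weight function $\omega$, the weighted space $L_{p(x),\omega}(\Omega)$ consists of the measurable $f$ with $\|f\|_{L_{p(x),\omega}(\Omega)}:=\|f\,\omega\|_{L_{p(\cdot)}(\Omega)}<\infty$ (the weight multiplies the function). $L_{\underline p}(\mathbb{R}^n)$ is the usual Lebesgue space with constant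 exponent $\underline p$. The notation $L_{p(\cdot)}(|\cdot|>t)$ means $L_{p(\cdot)}(\{x\in\mathbb{R}^n:|x|>t\})$, and similarly for $L_{p(\cdot)}(|\cdot|<t)$. The conjugate exponent is $\overline p^{\,\prime}=\overline p/(\overline p-1)$. At points where $p(x)=\underline p$, the exponent $\frac{\underline p\,p(x)}{p(x)-\underline p}$ is read as $+\infty$ and $\delta^{+\infty}=0$. An operator $T$ is sublinear if $|T(f+g)|\le|Tf|+|Tg|$ and $|T(\lambda f)|=|\lambda||Tf|$ almost everywhere, for all functions $f,g$ in its domain and scalars $\lambda$. It acts boundedly from $X$ to $Y$ if $\|Tf\|_Y\le K\|f\|_X$ for all $f\in X$, with $K$ independent of $f$. *)

(* Defs.v *)
From HB Require Import structures.
From mathcomp Require Import all_boot all_order all_algebra.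
From mathcomp Require Import all_classical all_reals all_analysis.

Set Implicit Arguments.
Unset Strict Implicit.
Unset Printing Implicit Defensive.

Import Order.TTheory GRing.Theory Num.Theory.
Import numFieldNormedType.Exports.

Local Open Scope classical_set_scope.
Local Open Scope ring_scope.

(* The norm `|x| that the library puts on 'rV[R]_n is the sup norm, hence a
   separate name for the Euclidean one; both induce the same topology. *)
Definition enorm (R : realType) (n : nat) (x : 'rV[R]_n) : R :=
  Num.sqrt (\sum_i x 0 i ^+ 2).

Section lebesgue_measure_Rn.
Context (R : realType) (n : nat).

Definition box (ab : 'rV[R]_n * 'rV[R]_n) : set 'rV[R]_n :=
  [set x | forall i, ab.1 0 i < x 0 i <= ab.2 0 i].

Definition box_volume (ab : 'rV[R]_n * 'rV[R]_n) : R :=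
  \prod_i Num.max 0 (ab.2 0 i - ab.1 0 i).

Lemma box_volume_ge0 ab : (0 <= (box_volume ab)%:E)%E.
Proof. by rewrite lee_fin; apply: prodr_ge0 => i _; rewrite le_max lexx. Qed.

Local Open Scope ereal_scope.

Definition box_cover (A : set 'rV[R]_n) : set (nat -> 'rV[R]_n * 'rV[R]_n) :=
  [set F | A `<=` \bigcup_k box (F k)].

Definition lebesgue_outer (A : set 'rV[R]_n) : \bar R :=
  ereal_inf [set \sum_(k <oo) (box_volume (F k))%:E | F in box_cover A].

End lebesgue_measure_Rn.

(* The dimension is written n.+1 from here on: in dimension 0 no box is empty,
   and covers by infinite sequences of boxes do not give the empty set measure
   zero. *)
Section lebesgue_outer_measure.
Context (R : realType) (n : nat).
Local Open Scope ereal_scope.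
Local Notation mu := (@lebesgue_outer R n.+1).

Lemma lebesgue_outer_ge0 A : 0 <= mu A.
Proof.
by apply: le_ereal_inf_tmp => _ [F _ <-]; apply: nneseries_ge0 => k _ _;
  exact: box_volume_ge0.
Qed.

Lemma lebesgue_outer0 : mu set0 = 0.
Proof.
apply/eqP; rewrite eq_le lebesgue_outer_ge0 andbT.
apply: ereal_inf_lbound; exists (fun=> (0%R, 0%R)) => //.
rewrite eseries0// => k _ _; rewrite /box_volume big_ord_recl subrr maxxx.
by rewrite mul0r.
Qed.

Lemma le_lebesgue_outer : {homo mu : A B / A `<=` B >-> A <= B}.
Proof.
move=> A B AB; apply/ereal_inf_le_tmp => x [F BF <-]; exists F => //.
exact: subset_trans AB BF.
Qed.

Lemma lebesgue_outer_sigma_subadditive : sigma_subadditive mu.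
Proof.
move=> A; have [[i ioo]|] := pselect (exists i, mu (A i) = +oo).
  rewrite (eseries_pinfty _ _ ioo) ?leey// => k _.
  by rewrite -ltNye (lt_le_trans _ (lebesgue_outer_ge0 _)).
rewrite -forallNE => Aoo.
suff add2e (e : {posnum R}) :
    mu (\bigcup_n A n) <= \sum_(i <oo) mu (A i) + e%:num%:E.
  by apply/lee_addgt0Pr => _/posnumP[].
rewrite (le_trans _ (epsilon_trick _ _ _))//; last first.
  by move=> k; exact: lebesgue_outer_ge0.
pose vol (F : 'rV[R]_n.+1 * 'rV[R]_n.+1) : \bar R := (box_volume F)%:E.
have vol0 F : 0 <= vol F by exact: box_volume_ge0.
pose P k (B : nat -> 'rV[R]_n.+1 * 'rV[R]_n.+1) := box_cover (A k) B /\
  \sum_(i <oo) vol (B i) <= mu (A k) + (e%:num / (2 ^ k.+1)%:R)%:E.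
have [G PG] : {G & forall k, P k (G k)}.
  apply: (@choice _ _ P) => k; rewrite /P /lebesgue_outer.
  set S := (X in ereal_inf X); move infS : (ereal_inf S) => iS.
  case: iS infS => [r Sr|Soo|Soo].
  - have en1 : (0 < e%:num / (2 ^ k.+1)%:R)%R by [].
    have /(lb_ereal_inf_adherent en1) : ereal_inf S \is a fin_num by rewrite Sr.
    move=> [x [B AnB muBx] xS].
    by exists B; split => //; rewrite muBx -Sr; exact/ltW.
  - by have := Aoo k; rewrite /lebesgue_outer Soo.
  - by have := lebesgue_outer_ge0 (A k); rewrite /lebesgue_outer -/S Soo.
have muG_ge0 x : 0 <= (vol \o uncurry G) x by exact: vol0.
apply: (@le_trans _ _ (\esum_(i in setT) (vol \o uncurry G) i)).
  rewrite /lebesgue_outer; apply: ereal_inf_lbound => /=.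
  have /card_esym/ppcard_eqP[f] := card_nat2.
  exists (uncurry G \o f).
    move=> t [i _] /(PG i).1 [j _ Bijt]; exists (f^-1%FUN (i, j)) => //=.
    by rewrite invK ?inE.
  rewrite -(esum_pred_image (vol \o uncurry G) _ xpredT) ?[fun=> _]set_true//.
  by rewrite image_eq.
rewrite (_ : esum _ _ = \sum_(i <oo) \sum_(j <oo ) vol (G i j)); last first.
  pose J : nat -> set (nat * nat) := fun i => [set (i, j) | j in setT].
  rewrite (_ : setT = \bigcup_k J k); last first.
    by rewrite predeqE => -[a b]; split => // _; exists a => //; exists b.
  rewrite esum_bigcupT /=; last 2 first.
    - apply/trivIsetP => i j _ _ ij.
      rewrite predeqE => -[k m] /=; split => //= -[] [_] _ [<-{k} _].
      by move=> [m' _] [] /esym/eqP; rewrite (negbTE ij).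
    - by move=> /= [k m].
  rewrite -(image_id [set: nat]) -fun_true esum_pred_image//; last first.
    by move=> k _; exact: esum_ge0.
  apply: eq_eseriesr => /= j _.
  rewrite -(esum_pred_image (vol \o uncurry G) (pair j) predT)//=; last first.
    by move=> ? ? _ _; exact: (@can_inj _ _ _ snd).
  by congr esum; rewrite predeqE => -[a b]; split; move=> [i _ <-]; exists i.
apply: lee_lim.
- apply: is_cvg_nneseries => k *.
  by apply: nneseries_ge0 => m *; exact: vol0.
- by apply: is_cvg_nneseries => k *; apply: adde_ge0 => //;
    exact: lebesgue_outer_ge0.
- by near=> k; apply: lee_sum => i _; exact: (PG i).2.
Unshelve. all: by end_near. Qed.

HB.instance Definition _ := isOuterMeasure.Build R 'rV[R]_n.+1
  (@lebesgue_outer R n.+1) lebesgue_outer0 lebesgue_outer_ge0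
  le_lebesgue_outer lebesgue_outer_sigma_subadditive.

Definition lebesgue_outer_measure : {outer_measure set 'rV[R]_n.+1 -> \bar R} :=
  mu.

(* Lebesgue measure, on the copy of 'rV[R]_n.+1 whose measurable sets are the
   Caratheodory-measurable ones, i.e. all Lebesgue (not only Borel) sets. *)
Definition Rn := caratheodory_type lebesgue_outer_measure.

Definition leb : {measure set Rn -> \bar R} :=
  (lebesgue_outer_measure : set (caratheodory_type lebesgue_outer_measure)
     -> \bar R).

End lebesgue_outer_measure.

Arguments leb : clear implicits.

Section variable_lebesgue.
Context (R : realType) (n : nat).
Implicit Types (p w : 'rV[R]_n.+1 -> R) (f : 'rV[R]_n.+1 -> R).
Local Open Scope ereal_scope.
Local Notation mu := (leb R n).

Definition lebesgue_measurable f := measurable_fun [set: Rn R n] f.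

Definition weight w :=
  [/\ lebesgue_measurable w, forall x, (0 <= w x)%R
    & {ae mu, forall x, (0 < w x)%R}].

(* The argument is extended-real valued because the Hardy-type conditions take
   the norm of functions built from integrals that may be infinite; the norm is
   +oo when no r is admissible. *)
Definition lux_norm p (D : set 'rV[R]_n.+1) (F : 'rV[R]_n.+1 -> \bar R) : \bar R :=
  ereal_inf [set r%:E | r in [set r : R |
    (0 < r)%R /\ \int[mu]_(x in D) (`|F x| * (r^-1)%:E) `^ (p x) <= 1]].

Definition wnorm p w f : \bar R :=
  lux_norm p setT (fun x => (f x * w x)%:E).

Definition wspace p w : set ('rV[R]_n.+1 -> R) :=
  [set f | lebesgue_measurable f /\ wnorm p w f < +oo].

(* The value of the integrand on {v = 0}, where powR gives 0 instead of +oo,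
   is immaterial for a weight v; likewise at the origin. *)
Definition inner_int v (q t : R) : \bar R :=
  \int[mu]_(y in [set y | enorm y < t]%R) (v y `^ (- q))%:E.

Definition outer_int v (q t : R) : \bar R :=
  \int[mu]_(y in [set y | t < enorm y]%R)
    ((v y * enorm y ^+ n.+1) `^ (- q))%:E.

Definition hardy_A p v w (q alpha : R) : \bar R :=
  ereal_sup [set inner_int v q t `^ (alpha / q) *
      lux_norm p [set x | t < enorm x]%R
        (fun x => (w x / enorm x ^+ n.+1)%:E *
                  inner_int v q (enorm x) `^ ((1 - alpha) / q))
    | t in [set t : R | 0 < t]%R].

Definition hardy_B p v w (q beta : R) : \bar R :=
  ereal_sup [set outer_int v q t `^ (beta / q) *
      lux_norm p [set x | enorm x < t]%R
        (fun x => (w x)%:E *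
                  outer_int v q (enorm x) `^ ((1 - beta) / q))
    | t in [set t : R | 0 < t]%R].

Definition supp f : set 'rV[R]_n.+1 := closure [set x | f x != 0%R].

(* An operator is a total map on functions together with a linear space D of
   measurable functions, its domain; its values outside D are irrelevant. *)
Definition sublinear_operator (D : set ('rV[R]_n.+1 -> R))
    (T : ('rV[R]_n.+1 -> R) -> 'rV[R]_n.+1 -> R) :=
  [/\ forall f, D f -> lebesgue_measurable f /\ lebesgue_measurable (T f),
      forall f g, D f -> D g -> D (fun x => f x + g x)%R,
      forall (c : R) f, D f -> D (fun x => c * f x)%R,
      forall f g, D f -> D g ->
        {ae mu, forall x, (`|T (fun y => f y + g y) x| <= `|T f x| + `|T g x|)%R}
    & forall (c : R) f, D f ->
        {ae mu, forall x, (`|T (fun y => c * f y) x| = `|c| * `|T f x|)%R}].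

End variable_lebesgue.

(* Main.v *)
(** The supremum over the shells around x != 0 dominates w x, while the bound
    on it involves the essential infimum of v over the whole space. Hence w is
    bounded (away from 0) by M m and v >= m almost everywhere, where m, the
    essential infimum of v, lies in ]0, +oo[. So weights cost only constants, and
    T factors as L_(p,v) -> L_p -> L_pmin -> L_p -> L_(p,w), where the second
    arrow is the embedding given by the integrability condition on delta. *)
Require Import Defs.
From mathcomp Require Import all_boot all_order all_algebra.
From mathcomp Require Import all_classical all_reals all_analysis.
From mathcomp Require Import ess_sup_inf hoelder measurable_realfun.
From mathcomp Require Import ring lra.

Import Order.TTheory GRing.Theory Num.Theory.
Import numFieldNormedType.Exports.

Local Open Scope classical_set_scope.
Local Open Scope ring_scope.

(** * The pointwise inequality behind the embedding *)

Section powR_lemmas.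
Context (R : realType).
Implicit Types a b d q s : R.

(* Either a >= d `^ (q / (s - q)), and the first summand suffices, or the second
   does. *)
Lemma powR_le_powR_add a d q s : 0 <= a -> 0 < d < 1 -> 0 < q -> q <= s ->
  (a * d) `^ q <= a `^ s + (if s == q then 0 else d `^ (q * s / (s - q))).
Proof.
move=> a0 /andP[d0 d1] q0 qs; have [->|sq] := eqVneq s q.
  rewrite addr0 ge0_ler_powR ?nnegrE ?mulr_ge0 ?(ltW q0) ?(ltW d0)//.
  by rewrite ler_piMr// ltW.
have sq0 : 0 < s - q by rewrite subr_gt0 lt_neqAle eq_sym sq.
have s0 : 0 < s by exact: lt_le_trans qs.
(* Chosen so that [(d]^ e) [^ (s - q) = d]^ q[and](e + 1) * q = q * s / (s -
   q)[: the first identity serves large]a[, the second turns]a * d < d [^ (e + 1)] into the other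
   bound. *)
set e := q / (s - q).
have e0 : 0 < e by rewrite divr_gt0.
have [ea|ae] := leP (d `^ e) a.
  have a_gt0 : 0 < a by rewrite (lt_le_trans _ ea)// powR_gt0.
  rewrite ler_wpDr ?powR_ge0// powRM ?(ltW d0)//.
  have -> : a `^ s = a `^ q * a `^ (s - q).
    by rewrite -powRD ?(gt_eqF a_gt0) ?implybT// addrC subrK.
  rewrite ler_wpM2l ?powR_ge0//.
  have -> : d `^ q = (d `^ e) `^ (s - q) by rewrite -powRrM /e divfK// gt_eqF.
  by rewrite ge0_ler_powR ?nnegrE ?powR_ge0 ?(ltW sq0).
rewrite ler_wpDl ?powR_ge0//.
have -> : q * s / (s - q) = (e + 1) * q.
  by rewrite /e; field; rewrite gt_eqF.
rewrite powRrM ge0_ler_powR ?nnegrE ?mulr_ge0 ?powR_ge0 ?(ltW q0) ?(ltW d0)//.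
rewrite powRD ?(gt_eqF d0) ?implybT// powRr1 ?(ltW d0)//.
by rewrite ler_wpM2r ?(ltW d0)// ltW.
Qed.

End powR_lemmas.

(** * Measurability of powers with variable exponent *)

Section measurability.
Context d (U : measurableType d) (R : realType).
Implicit Types f g : U -> R.

(** Since the exponent varies too, [powR] is unfolded: a case split on [f x == 0], with
    [expR (g x * ln (f x))] on the nonzero branch. *)
Lemma measurable_fun_powR f g : measurable_fun setT f -> measurable_fun setT g ->
  measurable_fun setT (fun x => f x `^ g x).
Proof.
move=> mf mg; rewrite /powR; apply: measurable_fun_ifT.
- exact: measurable_fun_eqr.
- have -> : (fun t => (g t == 0)%:R) = (fun t => if g t == 0 then 1 else 0 : R).
    by apply/funext => t; case: ifP.
  by apply: measurable_fun_ifT => //; exact: measurable_fun_eqr.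
- apply: measurableT_comp => //; apply: measurable_funM => //.
  by apply: measurableT_comp => //; exact: measurable_ln.
Qed.

(** For nonnegative values the inverse is the power -1, also at 0, where both are 0. *)
Lemma ge0_measurable_funV f : (forall x, 0 <= f x) -> measurable_fun setT f ->
  measurable_fun setT (fun x => (f x)^-1).
Proof.
move=> f0 mf; under eq_fun do rewrite -powR_inv1//.
exact: measurable_fun_powR.
Qed.

End measurability.

(** * The origin and its measure *)

Lemma enorm_gt0 (R : realType) (n : nat) (x : 'rV[R]_n) :
  x != 0 -> 0 < enorm x.
Proof.
move=> x0; rewrite /enorm sqrtr_gt0 lt_neqAle sumr_ge0 ?andbT => [|i _]; last first.
  exact: sqr_ge0.
apply: contra x0; rewrite eq_sym psumr_eq0 => [/allP x0|i _]; last exact: sqr_ge0.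
apply/eqP/rowP => i; apply/eqP; rewrite mxE -sqrf_eq0.
by have := x0 i; rewrite mem_index_enum; exact.
Qed.

Section ae_lebesgue.
Context (R : realType) (n : nat).
Local Open Scope ereal_scope.
Local Notation mu := (leb R n).

Lemma lebesgue_outer_origin : lebesgue_outer [set 0%R : 'rV[R]_n.+1] = 0.
Proof.
apply/eqP; rewrite eq_le lebesgue_outer_ge0 andbT.
apply/lee_addgt0Pr => e e0; rewrite add0e.
(* The box from [a] to 0 contains 0, boxes being closed on the right, and is thin in one direction
   only: its volume is [e]. All further boxes are degenerate. *)
pose a : 'rV[R]_n.+1 := (\row_i (if i == ord0 then - e else -1))%R.
pose F (k : nat) : 'rV[R]_n.+1 * 'rV[R]_n.+1 :=
  if k == 0%N then (a, 0%R) else (0%R, 0%R).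
apply: ereal_inf_lbound; exists F.
  move=> _ ->; exists 0%N => // i; rewrite !mxE lexx andbT.
  by case: ifP => _; rewrite oppr_lt0.
rewrite nneseries_recl//; last by move=> k _; exact: box_volume_ge0.
rewrite eseries0 ?adde0; last first.
  move=> k k0 _; rewrite /F gtn_eqF// /box_volume big_ord_recl/= !mxE.
  by rewrite subrr maxxx mul0r.
rewrite /box_volume big_ord_recl/= !mxE/= sub0r opprK (max_idPr _) ?(ltW e0)//.
rewrite big1 ?mulr1// => i _; rewrite !mxE/= sub0r opprK.
by apply/max_idPr.
Qed.

Lemma ae_neq0 : {ae mu, forall x : 'rV[R]_n.+1, x != 0%R}.
Proof.
have m0 : measurable ([set 0%R] : set (Rn R n)).
  (* A set of outer measure zero satisfies the Caratheodory criterion: its part of [X] contributes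
     nothing. *)
  apply: le_caratheodory_measurable => X; rewrite /=.
  rewrite (_ : lebesgue_outer (X `&` _) = 0) ?add0e.
    by apply: le_lebesgue_outer; exact: subIsetl.
  apply/eqP; rewrite eq_le lebesgue_outer_ge0 andbT -lebesgue_outer_origin.
  by apply: le_lebesgue_outer; exact: subIsetr.
exists [set 0%R]; split => //; first exact: lebesgue_outer_origin.
by move=> x /= /negP; rewrite negbK => /eqP.
Qed.

End ae_lebesgue.

(** * Luxemburg norms on an abstract measure space *)

Section luxemburg.
Context d (U : measurableType d) (R : realType).
Variable mu : {measure set U -> \bar R}.
Local Open Scope ereal_scope.
Implicit Types (p f g : U -> R).

(** A real-valued form of [lux_norm] on the whole space. On finite-valued functions the two agree by
    computation, so bounds on it apply directly to [wnorm]. *)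
Definition luxemburg p f : \bar R :=
  ereal_inf [set r%:E | r in [set r : R |
    (0 < r)%R /\ \int[mu]_x ((`|f x| / r) `^ p x)%:E <= 1]].

Lemma measurable_modular p f (r : R) :
  measurable_fun setT p -> measurable_fun setT f ->
  measurable_fun setT (fun x => ((`|f x| / r) `^ p x)%:E).
Proof.
move=> mp mf; apply/measurable_EFinP; apply: measurable_fun_powR => //.
by apply: measurable_funM => //; exact: measurableT_comp.
Qed.

(** If [r] is admissible for [f], then [c * r] is admissible for [g]. This is how bounds on the
    weights enter. *)
Lemma le_luxemburg p f g (c : R) : measurable_fun setT p ->
  (forall x, 0 <= p x)%R -> measurable_fun setT f -> measurable_fun setT g ->
  (0 < c)%R -> {ae mu, forall x, (`|g x| <= c * `|f x|)%R} ->
  luxemburg p g <= c%:E * luxemburg p f.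
Proof.
move=> mp p0 mf mg c0 gf; rewrite /luxemburg -ereal_inf_pZl//.
apply: le_ereal_inf_tmp => _ [_ [r [r0 fr] <-] <-].
apply: ereal_inf_lbound; exists (c * r)%R; last by [].
split; first exact: mulr_gt0.
apply: le_trans fr; apply: ae_ge0_le_integral => //.
- by move=> x _; rewrite lee_fin powR_ge0.
- exact: measurable_modular.
- by move=> x _; rewrite lee_fin powR_ge0.
- exact: measurable_modular.
apply: filterS gf => x gfx _; rewrite lee_fin ge0_ler_powR//.
- by rewrite nnegrE divr_ge0// ltW// mulr_gt0.
- by rewrite nnegrE divr_ge0// ltW.
rewrite ler_pdivrMr ?mulr_gt0// (le_trans gfx)// le_eqVlt.
by apply/orP; left; apply/eqP; field; rewrite gt_eqF.
Qed.

Lemma Lnorm_le_luxemburg p (q a : R) : measurable_fun setT p ->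
  (0 < q)%R -> (forall x, q <= p x)%R -> (0 < a < 1)%R ->
  \int[mu]_x (if p x == q then 0 else a `^ (q * p x / (p x - q)))%:E < +oo ->
  exists2 C : R, (0 < C)%R & forall f, measurable_fun setT f ->
    'N[mu]_(q%:E)[EFin \o f] <= C%:E * luxemburg p f.
Proof.
move=> mp q0 qp a01; have /andP[a0 a1] := a01.
set phi := fun x => (if p x == q then 0 else a `^ (q * p x / (p x - q)))%R.
rewrite -/(\int[mu]_x (phi x)%:E) => phioo.
have phi0 x : (0 <= phi x)%R by rewrite /phi; case: ifP => // _; exact: powR_ge0.
have mphi : measurable_fun setT phi.
  apply: measurable_fun_ifT => //; first exact: measurable_fun_eqr.
  apply: measurable_fun_powR => //; apply: measurable_funM.
    exact: measurable_funM.
  apply: ge0_measurable_funV => [x|]; first by rewrite subr_ge0.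
  exact: measurable_funB.
have : 0 <= \int[mu]_x (phi x)%:E by apply: integral_ge0 => x _; rewrite lee_fin.
case phiE : (\int[mu]_x _) phioo => [i|//|//] _; rewrite lee_fin => i0.
have i1 : (0 < 1 + i)%R by rewrite ltr_wpDr.
exists ((1 + i) `^ q^-1 / a)%R; first by rewrite divr_gt0// powR_gt0.
move=> f mf; rewrite /luxemburg -ereal_inf_pZl ?divr_gt0 ?powR_gt0//.
apply: le_ereal_inf_tmp => _ [_ [r [r0 fr] <-] <-].
have rd0 : (0 < r / a)%R by rewrite divr_gt0.
have mfr := measurable_modular p f r mp mf.
have fq : \int[mu]_x (`|(EFin \o f) x| `^ q) <= ((r / a) `^ q * (1 + i))%:E.
  apply: (@le_trans _ _ (\int[mu]_x (((r / a) `^ q)%:E *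
      (((`|f x| / r) `^ p x)%:E + (phi x)%:E)))).
    apply: ge0_le_integral => //.
    - by move=> x _; exact: poweR_ge0.
    - apply/measurable_EFinP; apply: measurable_fun_powR => //.
      exact: measurableT_comp.
    - apply: measurable_funeM; apply: emeasurable_funD => //.
      exact/measurable_EFinP.
    move=> x _; rewrite -EFinD -EFinM lee_fin.
    have -> : (`|f x| `^ q = (r / a) `^ q * (`|f x| / r * a) `^ q)%R.
      rewrite -powRM ?(ltW rd0) ?mulr_ge0 ?invr_ge0 ?(ltW r0) ?(ltW a0)//.
      by congr powR; field; rewrite !gt_eqF.
    rewrite ler_wpM2l ?powR_ge0//.
    by apply: powR_le_powR_add => //; rewrite divr_ge0// ltW.
  rewrite ge0_integralZl//; first last.
  - by rewrite lee_fin powR_ge0.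
  - by move=> x _; rewrite -EFinD lee_fin addr_ge0// powR_ge0.
  - by apply: emeasurable_funD => //; exact/measurable_EFinP.
  rewrite EFinM lee_pmul2l ?lte_fin ?powR_gt0// ge0_integralD//; first last.
  - exact/measurable_EFinP.
  - by move=> x _; rewrite lee_fin.
  - by move=> x _; rewrite lee_fin powR_ge0.
  by rewrite phiE EFinD leeD.
rewrite unlock.
apply: le_trans (gt0_ler_poweR _ _ _ fq) _.
- by rewrite invr_ge0 ltW.
- by rewrite in_itv/= leey andbT integral_ge0// => x _; exact: poweR_ge0.
- by rewrite in_itv/= leey andbT lee_fin mulr_ge0 ?powR_ge0 ?(ltW i1).
rewrite poweR_EFin lee_fin powRM ?powR_ge0 ?(ltW i1)//.
rewrite -powRrM mulfV ?gt_eqF// powRr1 ?(ltW rd0)//.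
by rewrite mulrC mulrA mulrAC.
Qed.

End luxemburg.

Arguments luxemburg {d U R} mu p f.
Arguments le_luxemburg {d U R} mu p f g c.
Arguments Lnorm_le_luxemburg {d U R mu p q a}.

(** * Boundedness of [T] between the weighted spaces *)

Theorem theorem1 (R : realType) (n : nat)
  (p : 'rV[R]_n.+1 -> R) (pmin pmax : R)
  (p_meas : lebesgue_measurable p)
  (p_ge1 : forall x, 1 <= p x)
  (pminE : ess_infr (leb R n) p = pmin%:E)
  (pmaxE : ess_supr (leb R n) p = pmax%:E)
  (pmin_gt1 : 1 < pmin)
  (p_bounds : forall x, pmin <= p x <= pmax)
  (delta : R) (delta01 : 0 < delta < 1)
  (delta_int : (\int[leb R n]_x
     (if p x == pmin then 0
      else delta `^ (pmin * p x / (p x - pmin)))%:E < +oo)%E)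
  (D : set ('rV[R]_n.+1 -> R))
  (T : ('rV[R]_n.+1 -> R) -> 'rV[R]_n.+1 -> R)
  (T_sublinear : sublinear_operator D T)
  (D_Lpmin : forall f, f \in Lfun (leb R n) pmin%:E -> D f)
  (D_L1c : forall f, f \in Lfun (leb R n) 1%E -> compact (supp f) -> D f)
  (T_bounded : exists K : R, forall f, f \in Lfun (leb R n) pmin%:E ->
     (lux_norm p setT (EFin \o T f) <=
      K%:E * 'N[leb R n]_(pmin%:E)[EFin \o f])%E)
  (C0 : R) (C0_gt0 : 0 < C0)
  (T_size : forall f, f \in Lfun (leb R n) 1%E -> compact (supp f) ->
     forall x, ~ supp f x ->
     (`|T f x|%:E <=
      C0%:E * \int[leb R n]_y (`|f y| / enorm (x - y) ^+ n.+1)%:E)%E)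
  (v w : 'rV[R]_n.+1 -> R) (v_weight : weight v) (w_weight : weight w)
  (alpha beta : R) (alpha01 : 0 < alpha < 1) (beta01 : 0 < beta < 1)
  (A_fin : (hardy_A p v w (pmax / (pmax - 1)) alpha < +oo)%E)
  (B_fin : (hardy_B p v w (pmax / (pmax - 1)) beta < +oo)%E)
  (M : R) (M_gt0 : 0 < M)
  (vw : forall x : 'rV[R]_n.+1, x != 0 ->
     (ereal_sup [set (w y)%:E
        | y in [set y | (enorm x / 4 < enorm y <= 4 * enorm x)%R]]
      <= M%:E * ess_infr (leb R n) v)%E) :
  exists2 C : R, 0 < C &
    forall f, wspace p v f -> (wnorm p w (T f) <= C%:E * wnorm p v f)%E.
Proof.
set mu := leb R n in pminE pmaxE delta_int T_bounded vw *.
have aeF := ae_filter_ringOfSetsType mu.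
(* Otherwise every essential infimum would be +oo, contradicting pminE. *)
have nontriv : ~ {ae mu, forall x : 'rV[R]_n.+1, False}.
  move=> F; suff : ess_infr mu p = +oo%E by rewrite pminE.
  by apply/ess_inf_eqyP; apply: (@filterS _ _ aeF) F.
have w_le x : x != 0 -> ((w x)%:E <= M%:E * ess_infr mu v)%E.
  move=> x0; apply: le_trans (vw x x0); apply: ereal_sup_ubound.
  exists x => //=; have := enorm_gt0 _ _ _ x0.
  by move: (enorm x) => e e0; apply/andP; split; lra.
have [m [m0 mE]] : exists m, 0 < m /\ ess_infr mu v = m%:E.
  have Ey : ess_infr mu v <> +oo%E.
    move=> /ess_inf_eqyP F; apply: nontriv; exact: (@filterS _ _ aeF) F.
  (* If the essential infimum were nonpositive, [w] would be nonpositive off the origin, against its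
     positivity almost everywhere. *)
  have [E0|] := leP (ess_infr mu v) 0%E.
    exfalso; apply: nontriv; have [_ _ w0] := w_weight.
    apply: (@filterS2 _ _ aeF) (ae_neq0 R n) w0 => x x0.
    apply/negP; rewrite -leNgt -lee_fin (le_trans (w_le x x0))//.
    by rewrite mule_ge0_le0// lee_fin ltW.
  by case: (ess_infr mu v) Ey => [m _|//|//]; rewrite lte_fin => m0; exists m.
have v_ge : {ae mu, forall x, m <= v x}.
  by have := ess_inf_le mu (EFin \o v); rewrite mE.
have p_ge0 x : 0 <= p x by rewrite (le_trans _ (p_ge1 x)).
have pmin0 : 0 < pmin by rewrite (lt_trans _ pmin_gt1).
have p_ge x : pmin <= p x by have /andP[] := p_bounds x.
have [C1 C10 embed] := Lnorm_le_luxemburg p_meas pmin0 p_ge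
  delta01 delta_int.
have [K T_le] := T_bounded.
(* [K] may be nonpositive; enlarging it keeps the bound, as the norm it multiplies is
   nonnegative. *)
pose K1 := Num.max K 1.
have K10 : 0 < K1 by rewrite lt_max ltr01 orbT.
have [v_meas v0 _] := v_weight; have [w_meas w0 _] := w_weight.
have [T_meas _ _ _ _] := T_sublinear.
(* From right to left: removing [v], the embedding, the bound on [T], and inserting [w]. *)
exists (M * m * (K1 * (C1 * m^-1))); first by rewrite !mulr_gt0 ?invr_gt0.
move=> f [f_meas f_lty].
have fv_meas : measurable_fun [set: Rn R n] (fun x => f x * v x).
  exact: measurable_funM.
have f_le : (luxemburg mu p f <= (m^-1)%:E * wnorm p v f)%E.
  apply: (le_luxemburg mu p (fun x => f x * v x) f) => //.
    by rewrite invr_gt0.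
  apply: (@filterS _ _ aeF) v_ge => x mv.
  by rewrite normrM mulrC -mulrA ler_peMr// ler_pdivlMr// mul1r ger0_norm.
have Nf_le := embed f f_meas.
(* Finiteness of the weighted norm passes through the embedding, which puts [f] in the domain of
   [T]. *)
have fL : f \in Lfun mu pmin%:E.
  apply/andP; split; first by rewrite inE.
  rewrite inE /= /finite_norm; apply: (le_lt_trans Nf_le).
  apply: lte_mul_pinfty; [by rewrite lee_fin ltW|by []|].
  apply: (le_lt_trans f_le).
  by apply: lte_mul_pinfty; [rewrite lee_fin invr_ge0 ltW|by []|exact: f_lty].
have Tf_meas : measurable_fun [set: Rn R n] (T f) by have [] := T_meas f (D_Lpmin f fL).
have Tf_le : (wnorm p w (T f) <= (M * m)%:E * luxemburg mu p (T f))%E.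
  apply: (le_luxemburg mu p (T f) (fun x => T f x * w x)).
  - exact: p_meas.
  - exact: p_ge0.
  - exact: Tf_meas.
  - exact: measurable_funM.
  - exact: mulr_gt0.
  apply: (@filterS _ _ aeF) (ae_neq0 R n) => x x0.
  rewrite normrM mulrC ler_wpM2r// ger0_norm//.
  by rewrite -lee_fin EFinM -mE w_le.
apply: (le_trans Tf_le); rewrite [in leRHS]EFinM -muleA.
apply: lee_wpmul2l; first by rewrite lee_fin mulr_ge0 ?ltW.
apply: (le_trans (T_le f fL)); rewrite EFinM -muleA.
apply: (@le_trans _ _ (K1%:E * 'N[mu]_(pmin%:E)[EFin \o f])%E).
  apply: lee_wpmul2r; first exact: Lnorm_ge0.
  by rewrite lee_fin le_max lexx.
apply: lee_wpmul2l; first by rewrite lee_fin ltW.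
apply: (le_trans Nf_le); rewrite EFinM -muleA.
apply: lee_wpmul2l; last exact: f_le.
by rewrite lee_fin ltW.
Qed.
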